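(* There is an absolute constant $c_2>0$ such that the following holds. Let $n$ and $k$ be integers with $c_2\log n<k\le n$. Any algorithm (read-once branching program) that, given a stream of samples, distinguishes between the uniform distribution $D_0$ on $\mathbb{F}_2^n=\{0,1\}^n$ and the distribution $D_1(S)$ (uniform on $S$) for an unknown $k$-dimensional linear subspace $S\subseteq\mathbb{F}_2^n$ chosen uniformly at random, with success probability at least $\frac12+2^{-o(k)}$, requires either memory of size $\Omega(k^2)$ or $2^{\Omega(k)}$ samples.
   Context: Let $L(k,n)$ denote the set of all $k$-dimensional linear subspaces of $\mathbb{F}_2^n$. A branching program for a distinguishing problem of length $m$ and width $d$ is a directed multigraph with vertices in $m+1$ layers, each containing at most $d$ vertices; layer 0 has a single start vertex; each non-leaf vertex has one outgoing edge for each possible sample value, going to the next layer; all vertices in the last layer are leaves, and each leaf is labeled with an output bit in $\{0,1\}$. On a stream of samples $u_1,\dots,u_m$ the program follows the edges labeled by the samples from the start vertex and outputs the label of the leaf reached. An algorithm with memory $b$ corresponds to a branching program of width $2^b$; the number of samples is the length $m$. The success probability of a distinguisher $L$ using $m$ samples is $$\frac{\Pr_{u_1,\dots,u_m\sim D_0}[L(u_1,\dots,u_m)=0]+\Pr_{S\in_R L(k,n);\,u_1,\dots,u_m\sim D_1(S)}[L(u_1,\dots,u_m)=1]}{2},$$ with samples drawn independently. *)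

(* Defs.v *)
From mathcomp Require Import all_boot all_order all_algebra.
From mathcomp Require Import all_classical all_reals all_analysis.

Set Implicit Arguments.
Unset Strict Implicit.
Unset Printing Implicit Defensive.

Import Order.TTheory GRing.Theory Num.Theory.
Import numFieldNormedType.Exports.

Local Open Scope ring_scope.

(* [inl b] is a leaf labeled [b]; [inr e] is a non-leaf whose edge for the
   sample [x] goes to [e x].  Leaves may occur in any layer; if there are
   samples at all, [bp_edge] and the bound on [bp_layer] make every vertex of
   the last layer a leaf, and [bp_last] imposes it in all cases. *)
Record branching_program (X : finType) (m d : nat) := BranchingProgram {
  bp_vertex : finType;
  bp_layer : bp_vertex -> 'I_m.+1;
  bp_node : bp_vertex -> bool + {ffun X -> bp_vertex};
  bp_start : bp_vertex;
  bp_width : forall i : 'I_m.+1, (#|[set v | bp_layer v == i]| <= d)%N;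
  bp_layer0 : forall v, bp_layer v = ord0 <-> v = bp_start;
  bp_edge : forall v e, bp_node v = inr e ->
    forall x, nat_of_ord (bp_layer (e x)) = (bp_layer v).+1;
  bp_last : forall v, bp_layer v = ord_max -> exists b, bp_node v = inl b
}.

Section Run.
Variables (X : finType) (m d : nat) (B : branching_program X m d).

Definition bp_step (v : bp_vertex B) (x : X) : bp_vertex B :=
  if bp_node v is inr e then e x else v.

Definition bp_end (u : m.-tuple X) : bp_vertex B :=
  foldl bp_step (bp_start B) u.

(* By [bp_end_leaf] the default value is never used. *)
Definition bp_output (u : m.-tuple X) : bool :=
  if bp_node (bp_end u) is inl b then b else false.

Lemma bp_end_leaf (u : m.-tuple X) : exists b, bp_node (bp_end u) = inl b.
Proof.
have run (s : seq X) (v : bp_vertex B) : (m <= bp_layer v + size s)%N ->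
    exists b, bp_node (foldl bp_step v s) = inl b.
  elim: s v => [|x s IHs] v /= mv.
    apply: bp_last; apply/val_inj/eqP => /=.
    by rewrite eqn_leq -ltnS ltn_ord /= -[X in (_ <= X)%N]addn0.
  case E: (bp_node v) => [b|e].
    have st y : bp_step v y = v by rewrite /bp_step E.
    exists b; rewrite st; suff -> : foldl bp_step v s = v by [].
    by elim: s {IHs mv} => //= y t; rewrite st.
  by apply: IHs; rewrite /bp_step E (bp_edge E) addSnnS.
by apply: run; rewrite size_tuple leq_addl.
Qed.

End Run.

Section Distinguishing.
Variable R : realType.

Definition uniform_pmf (X : finType) (A : {set X}) (x : X) : R :=
  if x \in A then #|A|%:R^-1 else 0.

Definition iid_prob (X : finType) (D : X -> R) (m : nat)
    (E : pred (m.-tuple X)) : R :=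
  \sum_(u : m.-tuple X | E u) \prod_(i < m) D (tnth u i).

Definition subspaces (k n : nat) : {set {set 'rV['F_2]_n}} :=
  [set S : {set 'rV['F_2]_n} |
    `[< exists2 W : {vspace 'rV['F_2]_n}, \dim W = k & S = [set v in W] >]].

Definition D0 (n : nat) : 'rV['F_2]_n -> R :=
  uniform_pmf [set: 'rV['F_2]_n].

Definition D1 (n : nat) (S : {set 'rV['F_2]_n}) : 'rV['F_2]_n -> R :=
  uniform_pmf S.

Definition success_prob (n k m d : nat)
    (B : branching_program 'rV['F_2]_n m d) : R :=
  (iid_prob (@D0 n) (fun u : m.-tuple 'rV['F_2]_n => ~~ bp_output B u)
   + \sum_(S in subspaces k n) uniform_pmf (subspaces k n) S
       * iid_prob (D1 S) (fun u : m.-tuple 'rV['F_2]_n => bp_output B u)) / 2.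

End Distinguishing.

(* Main.v *)
Require Import Defs.
From mathcomp Require Import all_boot all_order all_algebra.
From mathcomp Require Import all_field all_character.
From mathcomp Require Import all_classical all_reals all_analysis.
From mathcomp Require Import zify ring lra.

(** A uniform j-dimensional subspace is a uniform hyperplane of a uniform subspace
T of dimension j+1.  So for each j from k to n-1 it suffices to distinguish,
for every fixed T, uniform samples in T from uniform samples in a random
hyperplane S of T; there are at most n <= 2^O(k) such hybrids.

On T the functions chi_S (1 on S, -1 off S) have mean zero and are
orthonormal, and the uniform density of S is 1 + chi_S.  For a vertex v at
time t let p(v) be the probability of v under uniform samples and G(S, v) the
probability of v under samples in S, truncated at each step to at most K p(v).
By Bessel's inequality the bound G <= K p makes the next sample look uniform on
average over S, up to K / sqrt(number of hyperplanes).  So the advantage is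
controlled by the mass lost in truncation.

For a density g <= L on the hyperplanes, the potential
  Phi(g) = sum_v p(v) (E_S[g(S) G(S, v)] / p(v))^Q
starts at 1; merging vertices does not increase it (Jensen), and reading a
sample multiplies Phi + 1 by at most 1 + 4^Q K L / #hyperplanes, again by
orthonormality.  If v is truncated on a set of hyperplanes of density at least
1 / L, taking g to be the normalised indicator of that set gives
p(v) K^Q <= Phi(g) = O(1).  With K = 2^Theta(k) and Q = Theta(k) such vertices
have p(v) <= 2^-Omega(k^2), which beats the number of vertices. *)

Set Implicit Arguments.
Unset Strict Implicit.
Unset Printing Implicit Defensive.

Import Order.TTheory GRing.Theory Num.Theory.
Import numFieldNormedType.Exports.

Local Open Scope ring_scope.

(** * Elementary inequalities for powers *)

Section PowerInequalities.
Variable R : realFieldType.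
Implicit Types (s a y c : R) (q : nat).

(** Multiplying the bound for [q] by [1 + s] raises the quadratic coefficient to at most
    [q + 2 * 4 ^ q], which [4 ^ q.+1] absorbs. The linear term is kept apart because it averages to
    zero in [moment_step]. *)
Lemma expr1D_le q s : -1 <= s -> s <= 1 ->
  (1 + s) ^+ q <= 1 + q%:R * s + 4 ^+ q * s ^+ 2.
Proof.
move=> s1 s2; have s20 : 0 <= s ^+ 2 by rewrite sqr_ge0.
elim: q => [|q IH]; first by rewrite !expr0 mul0r; lra.
have := ler_wpM2l (_ : 0 <= 1 + s) IH; rewrite -exprS => /(_ ltac:(lra)) h.
apply: le_trans h _.
have q4 : (q%:R : R) <= 4 ^+ q.
  by rewrite -natrX ler_nat ltnW // ltn_expl.
have p4 : (0 : R) <= 4 ^+ q by rewrite exprn_ge0.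
rewrite [4 ^+ q.+1]exprS -[q.+1%:R]natr1.
set a := 4 ^+ q in q4 p4 *; set b := q%:R in q4 *.
have c0 : 0 <= (a - b) * s ^+ 2 by apply: mulr_ge0 => //; lra.
have c1 : 0 <= a * (1 - s) by apply: mulr_ge0 => //; lra.
have c2 := mulr_ge0 c1 s20; have c3 := mulr_ge0 p4 s20.
by lra.
Qed.

(** Convexity of the power; the inductive step leaves a nonnegative multiple of [(y - c) ^+ 2]. *)
Lemma expr_tangent q y c : 0 <= y -> 0 <= c ->
  c ^+ q.+1 + q.+1%:R * c ^+ q * (y - c) <= y ^+ q.+1.
Proof.
move=> y0 c0; elim: q => [|q IH]; first by rewrite expr0 !expr1; lra.
have := ler_wpM2l y0 IH; rewrite -exprS; apply: le_trans.
rewrite -[q.+2%:R]natr1 !exprS.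
have : 0 <= (q.+1%:R * c ^+ q) * (y - c) ^+ 2.
  by apply: mulr_ge0 (sqr_ge0 _); rewrite mulr_ge0 ?exprn_ge0.
set z := c ^+ q; set b := q.+1%:R; lra.
Qed.

(** Sum the tangent inequalities at the weighted mean. The weights are not normalised: they will be
    the probabilities of the transitions into one vertex. *)
Lemma jensen_expr (I : finType) (P : pred I) (w y : I -> R) q :
    (forall i, P i -> 0 <= w i) -> (forall i, P i -> 0 <= y i) ->
  let W := \sum_(i | P i) w i in
  W * ((\sum_(i | P i) w i * y i) / W) ^+ q.+1
    <= \sum_(i | P i) w i * y i ^+ q.+1.
Proof.
move=> w0 y0 /=; set W := \sum_(i | P i) w i; have [->|Wn0] := eqVneq W 0.
  by rewrite mul0r sumr_ge0 // => i Pi; rewrite mulr_ge0 ?exprn_ge0 ?w0 ?y0.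
set c := _ / W.
have cW : \sum_(i | P i) w i * y i = c * W by rewrite /c divfK.
have c0 : 0 <= c.
  by rewrite divr_ge0 ?sumr_ge0 // => i Pi; rewrite mulr_ge0 ?w0 ?y0.
have -> : W * c ^+ q.+1
    = \sum_(i | P i) w i * (c ^+ q.+1 + q.+1%:R * c ^+ q * (y i - c)).
  transitivity (\sum_(i | P i) (c ^+ q.+1 * w i
     + (q.+1%:R * c ^+ q) * (w i * y i) - (q.+1%:R * c ^+ q * c) * w i)).
    rewrite sumrB big_split /= -!mulr_sumr cW -/W; ring.
  by apply: eq_bigr => i _; ring.
by apply: ler_sum => i Pi; rewrite ler_wpM2l ?w0 // expr_tangent ?y0.
Qed.

(** Serves to deduce [(1 + x) ^+ t <= 2] from [x *+ t <= 2^-1]. *)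
Lemma expr1D_sub_le1 (x : R) t : 0 <= x -> x *+ t <= 1 ->
  (1 + x) ^+ t * (1 - x *+ t) <= 1.
Proof.
move=> x0; elim: t => [|t IH] xt; first by rewrite expr0 mulr0n; lra.
have xt' : x *+ t <= 1 by rewrite (le_trans _ xt) // mulrS lerDr.
apply: le_trans (IH xt'); rewrite exprSr -mulrA ler_wpM2l ?exprn_ge0 //; first lra.
have := mulr_ge0 x0 (mulrn_wge0 t x0); have := mulr_ge0 x0 x0.
by rewrite mulrS; lra.
Qed.

End PowerInequalities.

(** * Averages over a finite set *)

Section Average.
Variables (R : realFieldType) (I : finType) (H : {set I}).
Implicit Types u w : I -> R.

Definition ave u : R := (\sum_(i in H) u i) / #|H|%:R.

Lemma eq_ave u w : {in H, u =1 w} -> ave u = ave w.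
Proof. by move=> uw; congr (_ / _); apply: eq_bigr => i /uw. Qed.

Lemma aveD u w : ave (fun i => u i + w i) = ave u + ave w.
Proof. by rewrite /ave big_split mulrDl. Qed.

Lemma aveZ c u : ave (fun i => c * u i) = c * ave u.
Proof. by rewrite /ave -mulr_sumr mulrA. Qed.

Lemma ave_sum (J : finType) (P : pred J) (F : I -> J -> R) :
  ave (fun i => \sum_(j | P j) F i j) = \sum_(j | P j) ave (F^~ j).
Proof. by rewrite /ave exchange_big mulr_suml. Qed.

Lemma ler_ave u w : {in H, forall i, u i <= w i} -> ave u <= ave w.
Proof.
by move=> uw; rewrite ler_wpM2r ?invr_ge0 ?ler0n //; apply: ler_sum => i /uw.
Qed.

Lemma ave_ge0 u : {in H, forall i, 0 <= u i} -> 0 <= ave u.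
Proof. by move=> u0; rewrite divr_ge0 ?ler0n ?sumr_ge0 // => i /u0. Qed.

Lemma ave_cst c : (0 < #|H|)%N -> ave (fun=> c) = c.
Proof.
by move=> H0; rewrite /ave sumr_const -[c *+ _]mulr_natr mulfK // pnatr_eq0 -lt0n.
Qed.

End Average.

(** * Distribution of the current vertex along a stream *)

Section Stream.
Variables (R : realFieldType) (X V : finType) (step : V -> X -> V) (s0 : V).
Implicit Types (D : X -> R) (p : V -> R).

(** Transition operator of the chain on vertices. [p] need not have mass 1, so truncated masses can
    be pushed too. *)
Definition push D p (w : V) : R :=
  \sum_(e : V * X | step e.1 e.2 == w) D e.2 * p e.1.

Definition reach D t : V -> R := iter t (push D) (fun v => (v == s0)%:R).
Arguments reach : simpl never.

Lemma reach0 D v : reach D 0 v = (v == s0)%:R. Proof. by []. Qed.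

Lemma reachS D t : reach D t.+1 = push D (reach D t). Proof. by []. Qed.

Lemma push_sum D p (phi : V -> R) :
  \sum_w push D p w * phi w = \sum_v \sum_x D x * p v * phi (step v x).
Proof.
rewrite pair_bigA (partition_big (fun e : V * X => step e.1 e.2) predT) //=.
by apply: eq_bigr => w _; rewrite mulr_suml; apply: eq_bigr => e /eqP <-.
Qed.

Lemma push_mass D p : \sum_x D x = 1 -> \sum_w push D p w = \sum_v p v.
Proof.
move=> D1; transitivity (\sum_w push D p w * 1).
  by apply: eq_bigr => w _; rewrite mulr1.
rewrite (push_sum D p (fun=> 1)); apply: eq_bigr => v _.
by under eq_bigr do rewrite mulr1; rewrite -mulr_suml D1 mul1r.
Qed.

Lemma push_ge0 D p : (forall x, 0 <= D x) -> (forall v, 0 <= p v) ->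
  forall w, 0 <= push D p w.
Proof. by move=> D0 p0 w; rewrite sumr_ge0 // => e _; rewrite mulr_ge0. Qed.

Lemma ler_push D p p' : (forall x, 0 <= D x) -> (forall v, p v <= p' v) ->
  forall w, push D p w <= push D p' w.
Proof. by move=> D0 pp' w; apply: ler_sum => e _; rewrite ler_wpM2l. Qed.

Lemma reach_ge0 D t : (forall x, 0 <= D x) -> forall v, 0 <= reach D t v.
Proof.
by move=> D0; elim: t => [|t IH] v; [rewrite reach0 ler0n|rewrite reachS push_ge0].
Qed.

Lemma sum_start : \sum_v (v == s0)%:R = 1 :> R.
Proof.
rewrite (bigD1 s0) //= eqxx big1 ?addr0 // => v /negbTE ->; exact: erefl.
Qed.

Lemma reach_mass D t : \sum_x D x = 1 -> \sum_v reach D t v = 1.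
Proof.
by move=> D1; elim: t => [|t IH]; [exact: sum_start|rewrite reachS push_mass].
Qed.

End Stream.
Arguments reach : simpl never.

(** * Samples tilted by a hidden member of an orthonormal family *)

Section HiddenBias.
Variables (R : realFieldType) (X V I : finType).
Variables (step : V -> X -> V) (s0 : V) (D : X -> R) (H : {set I}).
Variable chi : I -> X -> R.

Hypothesis D_ge0 : forall x, 0 <= D x.
Hypothesis D_sum1 : \sum_x D x = 1.
Hypothesis H_gt0 : (0 < #|H|)%N.
Hypothesis chi_le1 : forall i x, -1 <= chi i x <= 1.
Hypothesis chi_mean : forall i, i \in H -> \sum_x D x * chi i x = 0.
Hypothesis chi_orth : forall i j, i \in H -> j \in H ->
  \sum_x D x * (chi i x * chi j x) = (i == j)%:R.

Local Notation M := (#|H|%:R : R).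
Local Notation E := (ave H).

(** Orthonormality kills the cross terms. The factor [1 / M] is the source of all the hardness:
    averaging over the hidden index flattens the signal. *)
Lemma second_moment (u : I -> R) :
  \sum_x D x * E (fun i => u i * chi i x) ^+ 2 = E (fun i => u i ^+ 2) / M.
Proof.
transitivity (\sum_x \sum_(i in H) \sum_(j in H)
    (D x * (chi i x * chi j x)) * (u i * u j / M ^+ 2)).
  apply: eq_bigr => x _; rewrite /ave exprMn expr2 mulr_suml mulrC -mulrA.
  rewrite mulr_suml; apply: eq_bigr => i _; rewrite mulr_sumr mulr_suml.
  by apply: eq_bigr => j _; rewrite exprVn; ring.
rewrite exchange_big /ave mulr_suml mulr_suml /=; apply: eq_bigr => i iH.
rewrite exchange_big (bigD1 i) //= -mulr_suml chi_orth // eqxx big1.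
  by rewrite addr0 mul1r -[RHS]mulrA -invfM -!expr2.
by move=> j /andP[jH ji]; rewrite -mulr_suml chi_orth // eq_sym (negbTE ji) mul0r.
Qed.

(** The average after sample [x] is [A + h x] with [|h x| <= A]. Expanding [(1 + h x / A) ^+ q.+1],
    the linear term has mean zero and the quadratic one is bounded by [second_moment] and
    [E u^2 <= U * A]. This costs [eta * A ^+ q], and [A ^+ q <= A ^+ q.+1 + 1]. *)
Lemma moment_step q (u : I -> R) (U : R) :
    {in H, forall i, 0 <= u i <= U} ->
  let eta := 4 ^+ q.+1 * U / M in
  \sum_x D x * E (fun i => (1 + chi i x) * u i) ^+ q.+1
    <= (1 + eta) * E u ^+ q.+1 + eta.
Proof.
move=> uU /=; set eta := 4 ^+ q.+1 * U / M; set A := E u.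
have M0 : 0 < M by rewrite ltr0n.
have /card_gt0P[i0 i0H] := H_gt0.
have U0 : 0 <= U by have /andP[] := uU _ i0H; apply: le_trans.
have u0 i : i \in H -> 0 <= u i by case/uU/andP.
have eta0 : 0 <= eta by rewrite !mulr_ge0 ?invr_ge0 ?exprn_ge0 // ltW.
have A0 : 0 <= A by apply: ave_ge0.
pose h x := E (fun i => u i * chi i x).
have hE x : E (fun i => (1 + chi i x) * u i) = A + h x.
  by rewrite -aveD; apply: eq_ave => i _; ring.
have hA x : - A <= h x <= A.
  rewrite -subr_ge0 opprK addrC -hE -(subr_ge0 (h x)); apply/andP; split.
    apply: ave_ge0 => i iH; rewrite mulr_ge0 ?u0 //.
    by have /andP[] := chi_le1 i x; lra.
  have -> : A - h x = E (fun i => (1 - chi i x) * u i).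
    rewrite -mulN1r -aveZ -aveD; apply: eq_ave => i _; ring.
  apply: ave_ge0 => i iH; rewrite mulr_ge0 ?u0 //.
  by have /andP[] := chi_le1 i x; lra.
have [Az|An] := eqVneq A 0.
  rewrite big1 ?Az ?expr0n ?mulr0 ?add0r // => x _.
  have := hA x; rewrite Az oppr0 -eq_le => /eqP hx.
  by rewrite hE -hx Az addr0 expr0n mulr0.
have Ap : 0 < A by rewrite lt_def An.
pose Q := q.+1.
have pt x : D x * E (fun i => (1 + chi i x) * u i) ^+ Q
    <= A ^+ Q * D x + (Q%:R * A ^+ q) * (D x * h x)
       + (4 ^+ Q * A ^+ Q / A ^+ 2) * (D x * h x ^+ 2).
  rewrite hE; have -> : A + h x = A * (1 + h x / A) by field.
  have /andP[h1 h2] := hA x.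
  have := @expr1D_le R Q (h x / A).
  rewrite ler_pdivlMr // mulN1r ler_pdivrMr // mul1r => /(_ h1 h2) hh.
  rewrite exprMn; have := ler_wpM2l (D_ge0 x) (ler_wpM2l (exprn_ge0 Q A0) hh).
  move/le_trans; apply; rewrite [A ^+ Q]exprS.
  by rewrite le_eqVlt; apply/orP; left; apply/eqP; field.
apply: le_trans (ler_sum _ (fun x _ => pt x)) _.
rewrite !big_split /= -!mulr_sumr D_sum1 second_moment.
have -> : \sum_x D x * h x = 0.
  transitivity (\sum_x E (fun i => u i * (D x * chi i x))).
    by apply: eq_bigr => x _; rewrite -aveZ; apply: eq_ave => i _; ring.
  rewrite -ave_sum -[RHS](ave_cst 0 H_gt0); apply: eq_ave => i iH.
  by rewrite -mulr_sumr chi_mean ?mulr0.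
have u2 : E (fun i => u i ^+ 2) <= U * A.
  rewrite -aveZ; apply: ler_ave => i iH; rewrite expr2 ler_wpM2r ?u0 //.
  by case/uU/andP: iH.
have Aq : A ^+ q <= A ^+ Q + 1.
  have [A1|/ltW A1] := leP A 1.
    by have := exprn_ile1 q A0 A1; have := exprn_ge0 Q A0; lra.
  by rewrite (le_trans (ler_weXn2l A1 (leqnSn q))) // lerDl ler01.
have c0 : 0 <= 4 ^+ Q * A ^+ Q / A ^+ 2.
  by apply: divr_ge0; [apply: mulr_ge0|]; rewrite exprn_ge0.
have := ler_wpM2l c0 (ler_wpM2r (_ : 0 <= M^-1) u2).
rewrite invr_ge0 (ltW M0) => /(_ isT).
have -> : 4 ^+ Q * A ^+ Q / A ^+ 2 * (U * A / M) = eta * A ^+ q.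
  by rewrite /eta [A ^+ Q]exprS; field; rewrite An (gt_eqF M0).
have := ler_wpM2l eta0 Aq; rewrite -/Q; lra.
Qed.


(** * The truncated process *)

Definition biased i x : R := D x * (1 + chi i x).
Local Notation p := (reach step s0 D).
Local Notation f i := (reach step s0 (biased i)).

Variable K : R.
Hypothesis K_ge1 : 1 <= K.

(** Mass above the cap is dropped for good. The cap keeps the ratio to [p] bounded, which
    [moment_step] and [ave_norm_le] require. *)
Fixpoint trunc t i : V -> R :=
  if t is t'.+1 then
    fun v => Num.min (push step (biased i) (trunc t' i) v) (K * p t v)
  else fun v => (v == s0)%:R.

Lemma biased_ge0 i x : 0 <= biased i x.
Proof. by rewrite mulr_ge0 //; have /andP[] := chi_le1 i x; lra. Qed.

Lemma biased_sum1 i : i \in H -> \sum_x biased i x = 1.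
Proof.
move=> iH; under eq_bigr do rewrite /biased mulrDr mulr1.
by rewrite big_split /= D_sum1 chi_mean ?addr0.
Qed.

Lemma p_ge0 t v : 0 <= p t v. Proof. exact: reach_ge0. Qed.

Lemma K_ge0 : 0 <= K. Proof. by apply: le_trans K_ge1. Qed.

Lemma trunc_ge0 t i v : 0 <= trunc t i v.
Proof.
elim: t v => [|t IH] v /=; first by rewrite ler0n.
rewrite le_min push_ge0 //=; last exact: biased_ge0.
by rewrite mulr_ge0 ?K_ge0 // p_ge0.
Qed.

Lemma trunc_le t i v : trunc t i v <= K * p t v.
Proof.
case: t => [|t] /=; last by rewrite ge_min lexx orbT.
by rewrite reach0 ler_peMl ?ler0n.
Qed.

Lemma trunc_le_reach t i v : trunc t i v <= f i t v.
Proof.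
elim: t v => [|t IH] v //=; rewrite reachS ge_min; apply/orP; left.
by apply: ler_push => //; exact: biased_ge0.
Qed.

(** A sample multiplies the cap by at most 2, since [1 + chi i x <= 2]. *)
Lemma push_trunc_le t i v : push step (biased i) (trunc t i) v <= 2 * K * p t.+1 v.
Proof.
rewrite reachS /push mulr_sumr; apply: ler_sum => e _.
have := trunc_le t i e.1; have /andP[_ c1] := chi_le1 i e.2.
have := trunc_ge0 t i e.1; rewrite /biased; set g := trunc _ _ _ => g0 gK.
have := ler_wpM2l (D_ge0 e.2) (ler_wpM2l g0 c1).
have := ler_wpM2l (D_ge0 e.2) gK; lra.
Qed.

Lemma truncE t i v : trunc t i v = p t v * (trunc t i v / p t v).
Proof.
have [pz|pn] := eqVneq (p t v) 0; last by rewrite mulrCA divff ?mulr1.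
have := trunc_le t i v; rewrite pz mulr0 => h; rewrite mul0r.
by apply/eqP; rewrite eq_le h trunc_ge0.
Qed.

(** * The moment potential *)

Section Potential.
Variables (q : nat) (L : R) (g : I -> R).
Hypothesis g_le : {in H, forall i, 0 <= g i <= L}.

(* Where [p t v = 0], [G] vanishes too and the junk value [0 / 0 = 0] is the
   right one. *)
Definition potential t (G : I -> V -> R) : R :=
  \sum_v p t v * (E (fun i => g i * G i v) / p t v) ^+ q.+1.

Local Notation Phi t := (potential t (trunc t)).
Local Notation PhiF t := (potential t.+1 (fun i => push step (biased i) (trunc t i))).

Let eta : R := 4 ^+ q.+1 * (L * K) / M.

(** The new ratio at [w] is a weighted mean of the values [y e] over the pairs [e] leading into [w].
    Jensen separates the merged pairs, and [moment_step] at each [v] bounds the sum over the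
    samples. *)
Lemma potential_push t : PhiF t <= (1 + eta) * Phi t + eta.
Proof.
pose u v i := g i * (trunc t i v / p t v).
have uLK v : {in H, forall i, 0 <= u v i <= L * K}.
  move=> i iH; have /andP[g0 gL] := g_le iH.
  have r0 : 0 <= trunc t i v / p t v by rewrite divr_ge0 ?trunc_ge0 ?p_ge0.
  rewrite mulr_ge0 //= ler_pM //.
  have := p_ge0 t v; rewrite le_eqVlt => /orP[/eqP <-|pp].
    by rewrite invr0 mulr0 K_ge0.
  by rewrite ler_pdivrMr // trunc_le.
pose y (e : V * X) := E (fun i => (1 + chi i e.2) * u e.1 i).
have y0 e : 0 <= y e.
  apply: ave_ge0 => i iH; rewrite mulr_ge0 //; last by case/andP: (uLK e.1 i iH).
  by have /andP[] := chi_le1 i e.2; lra.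
have -> : PhiF t = \sum_w (\sum_(e : V * X | step e.1 e.2 == w) D e.2 * p t e.1)
  * ((\sum_(e : V * X | step e.1 e.2 == w) D e.2 * p t e.1 * y e)
     / (\sum_(e : V * X | step e.1 e.2 == w) D e.2 * p t e.1)) ^+ q.+1.
  apply: eq_bigr => w _; congr (_ * (_ / _) ^+ _).
  transitivity (E (fun i => \sum_(e : V * X | step e.1 e.2 == w)
      (D e.2 * p t e.1) * ((1 + chi i e.2) * u e.1 i))).
    apply: eq_ave => i iH; rewrite mulr_sumr; apply: eq_bigr => e _.
    by rewrite [trunc t i e.1 in LHS]truncE /biased /u; ring.
  by rewrite ave_sum; apply: eq_bigr => e _; rewrite aveZ.
apply: (@le_trans _ _ (\sum_w \sum_(e : V * X | step e.1 e.2 == w)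
   D e.2 * p t e.1 * y e ^+ q.+1)).
  by apply: ler_sum => w _; apply: jensen_expr => // e _; rewrite mulr_ge0 ?p_ge0.
rewrite (_ : \sum_w _ = \sum_e D e.2 * p t e.1 * y e ^+ q.+1); last first.
  by rewrite [RHS](partition_big (fun e : V * X => step e.1 e.2) predT).
rewrite -(pair_bigA _ (fun v x => D x * p t v * y (v, x) ^+ q.+1)) /=.
have -> : (1 + eta) * Phi t + eta
    = \sum_v p t v * ((1 + eta) * E (u v) ^+ q.+1 + eta).
  under [RHS]eq_bigr do rewrite mulrDr mulrCA.
  rewrite big_split /= -mulr_sumr -mulr_suml (reach_mass _ _ _ D_sum1) mul1r.
  congr (_ * _ + _); apply: eq_bigr => v _; congr (_ * _ ^+ _).
  by rewrite mulrC -aveZ; apply: eq_ave => i _; rewrite /u; ring.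
apply: ler_sum => v _.
under eq_bigr do rewrite mulrAC mulrC.
rewrite -mulr_sumr ler_wpM2l ?p_ge0 //.
exact: (moment_step q (uLK v)).
Qed.

Lemma potential_trunc t : Phi t.+1 <= PhiF t.
Proof.
apply: ler_sum => w _; rewrite ler_wpM2l ?p_ge0 // lerXn2r ?nnegrE //.
- rewrite divr_ge0 ?p_ge0 // ave_ge0 // => i iH.
  by rewrite mulr_ge0 ?trunc_ge0 //; case/andP: (g_le iH).
- rewrite divr_ge0 ?p_ge0 // ave_ge0 // => i iH.
  rewrite mulr_ge0 ?push_ge0 //; first by case/andP: (g_le iH).
    exact: biased_ge0.
  by move=> v; apply: trunc_ge0.
rewrite ler_wpM2r ?invr_ge0 ?p_ge0 //; apply: ler_ave => i iH.
rewrite ler_wpM2l /= ?ge_min ?lexx //; by case/andP: (g_le iH).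
Qed.

(** Adding 1 makes the affine recursion geometric; the starting value is 2 because [E g = 1]. *)
Lemma potential_le t : E g = 1 -> 0 <= eta -> PhiF t + 1 <= 2 * (1 + eta) ^+ t.+1.
Proof.
move=> g1 eta0; have eta1 : 0 <= 1 + eta by lra.
suff h : Phi t + 1 <= 2 * (1 + eta) ^+ t.
  by have := potential_push t; have := ler_wpM2l eta1 h; rewrite exprS; lra.
elim: t => [|t IH].
  rewrite /potential (bigD1 s0) //= reach0 eqxx big1 => [|v /negbTE vs].
    2: by rewrite reach0 vs mul0r.
  rewrite mul1r addr0 expr0 divr1; under eq_ave do rewrite mulr1.
  by rewrite g1 expr1n; lra.
have := ler_wpM2l eta1 IH; have := potential_push t; have := potential_trunc t.
by rewrite exprS; lra.
Qed.

End Potential.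

(** * Mass lost by truncation, and total variation *)

Local Notation PhiF q t g :=
  (potential q g t.+1 (fun i => push step (biased i) (trunc t i))).

Lemma loss_le q (L C : R) t w : 0 < L -> 0 <= C ->
    (forall g, {in H, forall i, 0 <= g i <= L} -> E g = 1 -> PhiF q t g <= C) ->
  E (fun i => push step (biased i) (trunc t i) w - trunc t.+1 i w)
    <= 2 * K * (p t.+1 w / L + C / K ^+ q.+1).
Proof.
move=> L0 C0 PhiC; set P := p t.+1 w.
have M0 : 0 < M by rewrite ltr0n.
have Kp : 0 < K by apply: lt_le_trans K_ge1.
have P0 : 0 <= P by apply: p_ge0.
have KQ : 0 < K ^+ q.+1 by apply: exprn_gt0.
pose F i := push step (biased i) (trunc t i) w.
have F0 i : 0 <= F i.
  by apply: push_ge0 => [|v]; [exact: biased_ge0|exact: trunc_ge0].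
(* On [B] the excess is at most [2 * K * P], since one step at most doubles the
   bound [K].  If [B] has density at most [1 / L] this suffices; otherwise its
   normalised indicator [g] is an admissible weight for the potential. *)
pose B := [set i in H | K * P < F i].
have BH : B \subset H by apply/fintype.subsetP => i; rewrite inE => /andP[].
have BM : #|B|%:R <= M by rewrite ler_nat subset_leq_card.
have lossB : E (fun i => F i - trunc t.+1 i w) <= 2 * K * P * (#|B|%:R / M).
  have -> : #|B|%:R / M = E (fun i => (i \in B)%:R).
    congr (_ / _); rewrite -sum1_card natr_sum big_mkcond [RHS]big_mkcond /=.
    by apply: eq_bigr => i _; rewrite inE; case: (i \in H); case: (_ < _).
  rewrite -aveZ; apply: ler_ave => i iH; rewrite inE iH /=.
  have := push_trunc_le t i w; rewrite -/P -/(F i) => F2.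
  case: ltP => [KF|FK]; last by rewrite subrr mulr0.
  by rewrite mulr1; have := mulr_ge0 (ltW Kp) P0; lra.
apply: le_trans lossB _; rewrite -mulrA ler_pM2l ?mulr_gt0 //.
have [BL|BL] := leP (#|B|%:R * L) M.
  have h : #|B|%:R / M <= L^-1 by rewrite ler_pdivrMr // mulrC ler_pdivlMr.
  by have := ler_wpM2l P0 h; have := divr_ge0 C0 (ltW KQ); lra.
have B0 : 0 < #|B|%:R :> R.
  by rewrite -(pmulr_lgt0 _ L0) (lt_trans M0).
pose g i := if i \in B then M / #|B|%:R else 0.
have gL : {in H, forall i, 0 <= g i <= L}.
  move=> i _; rewrite /g; case: ifP => _; last by rewrite lexx ltW.
  by rewrite divr_ge0 ?ler0n //= ler_pdivrMr // mulrC ltW.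
have EgB (u : I -> R) : E (fun i => g i * u i) = (\sum_(i in B) u i) / #|B|%:R.
  rewrite /ave (big_setID B) /= (finset.setIidPr BH).
  rewrite addrC big1 ?add0r => [|i]; last first.
    by rewrite inE /g => /andP[/negbTE -> _]; rewrite mul0r.
  rewrite !mulr_suml; apply: eq_bigr => i iB; rewrite /g iB.
  by field; rewrite (gt_eqF B0) (gt_eqF M0).
have Eg1 : E g = 1.
  rewrite -(eq_ave (u := fun i => g i * 1)) => [|i _]; last by rewrite mulr1.
  by rewrite EgB sumr_const divff // (gt_eqF B0).
have Pp : 0 < P.
  move: B0; rewrite ltr0n => /card_gt0P[i]; rewrite inE => /andP[_ KF].
  have := push_trunc_le t i w; rewrite -/P -/(F i) => F2.
  rewrite -(pmulr_rgt0 _ Kp); lra.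
have KEP : K <= E (fun i => g i * F i) / P.
  rewrite ler_pdivlMr // EgB ler_pdivlMr // mulr_natr -sumr_const.
  by apply: ler_sum => i; rewrite inE => /andP[_ /ltW].
(* The term of [w] alone contributes at least [P * K ^+ q.+1] to the potential. *)
have PC : P <= C / K ^+ q.+1.
  rewrite ler_pdivlMr //; apply: le_trans (PhiC g gL Eg1).
  rewrite /potential (bigD1 w) //= -[leLHS]addr0 lerD //.
    rewrite ler_wpM2l // lerXn2r // ?nnegrE ?(ltW Kp) //.
    exact: le_trans (ltW Kp) KEP.
  rewrite sumr_ge0 // => v _; rewrite mulr_ge0 ?p_ge0 // exprn_ge0 //.
  rewrite divr_ge0 ?p_ge0 // ave_ge0 // => i iH.
  rewrite mulr_ge0 //; first by case/andP: (gL i iH).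
  by apply: push_ge0 => [|v']; [exact: biased_ge0|exact: trunc_ge0].
have h : #|B|%:R / M <= 1 by rewrite ler_pdivrMr // mul1r.
by have := ler_wpM2l P0 h; have := divr_ge0 P0 (ltW L0); lra.
Qed.

(** The bound [|h| <= c / 2 + h ^+ 2 / (2 * c)] replaces Cauchy-Schwarz and avoids square roots;
    [second_moment] does the rest. *)
Lemma ave_norm_le (u : I -> R) (r c : R) : 0 < c ->
    {in H, forall i, 0 <= u i <= r} ->
  \sum_x D x * `|E (fun i => u i * chi i x)| <= c / 2 + r ^+ 2 / (2 * c * M).
Proof.
move=> c0 ur.
have M0 : 0 < M by rewrite ltr0n.
apply: (@le_trans _ _ (\sum_x (c / 2 * D x
    + (2 * c)^-1 * (D x * E (fun i => u i * chi i x) ^+ 2)))).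
  apply: ler_sum => x _; set h := E _.
  have : `|h| <= c / 2 + (2 * c)^-1 * h ^+ 2.
    rewrite -real_normK ?num_real //; set a := `|h|.
    have -> : c / 2 + (2 * c)^-1 * a ^+ 2 = a + (c - a) ^+ 2 / (2 * c).
      by field; rewrite gt_eqF.
    by rewrite lerDl divr_ge0 ?sqr_ge0 // mulr_ge0 ?ltW.
  by move/(ler_wpM2l (D_ge0 x)); set k := (2 * c)^-1; lra.
rewrite big_split /= -!mulr_sumr D_sum1 mulr1 lerD2l.
rewrite second_moment.
have -> : r ^+ 2 / (2 * c * M) = (2 * c)^-1 * (r ^+ 2 / M).
  by field; rewrite (gt_eqF c0) (gt_eqF M0).
rewrite ler_pM2l ?invr_gt0 ?mulr_gt0 // ler_pM2r ?invr_gt0 //.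
rewrite -[leRHS](ave_cst _ H_gt0); apply: ler_ave => i iH.
have /andP[u0 u1] := ur i iH; rewrite lerXn2r ?nnegrE //; exact: le_trans u1.
Qed.

(* [s] is the parameter of the AM-GM inequality in [ave_norm_le]; its best value
   is [K / sqrt M]. *)
Definition drift (s L : R) q : R :=
  s / 2 + K ^+ 2 / (2 * s * M) + 4 * K * (L^-1 + #|V|%:R * 4 / K ^+ q.+1).

(** Induction on time for the sum of two errors: the distance from the averaged truncated process to
    [p], and the average mass truncated so far. Each step adds at most [drift]. *)
Lemma total_variation_le q (s L : R) m : 0 < s -> 0 < L ->
    (4 ^+ q.+1 * (L * K) / M) *+ m <= 2^-1 ->
  \sum_v `|E (fun i => f i m v) - p m v| <= m%:R * drift s L q.
Proof.
move=> s0' L0; set eta := 4 ^+ q.+1 * _ / _ => etam.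
have M0 : 0 < M by rewrite ltr0n.
have Kp : 0 < K by apply: lt_le_trans K_ge1.
have eta0 : 0 <= eta.
  by rewrite divr_ge0 ?ler0n // mulr_ge0 ?exprn_ge0 // mulr_ge0 ?ltW.
pose F t i w := push step (biased i) (trunc t i) w.
have loss t : (t < m)%N ->
    \sum_w E (fun i => F t i w - trunc t.+1 i w)
      <= 2 * K * (L^-1 + #|V|%:R * 4 / K ^+ q.+1).
  (* The 4 comes from [2 * (1 + eta) ^+ t.+1 <= 4], valid as [eta *+ m <= 2^-1]. *)
  move=> tm; have PhiC g : {in H, forall i, 0 <= g i <= L} -> E g = 1 ->
      PhiF q t g <= 4.
    move=> gL g1; have := potential_le gL t g1 eta0.
    have : eta *+ t.+1 <= 2^-1 by apply: le_trans etam; rewrite ler_wpMn2l.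
    rewrite -/eta; move: t.+1 => k ek hk.
    have := expr1D_sub_le1 eta0 (_ : eta *+ k <= 1) => /(_ ltac:(lra)).
    have := exprn_ge0 k (_ : 0 <= 1 + eta) => /(_ ltac:(lra)).
    set a := (1 + eta) ^+ k in hk *; move=> a0 h.
    have : a * (2^-1) <= a * (1 - eta *+ k) by rewrite ler_wpM2l //; lra.
    lra.
  apply: le_trans (ler_sum _ (fun w _ => loss_le w L0 (_ : 0 <= 4) PhiC)) _ => //.
  rewrite -mulr_sumr big_split /= -mulr_suml (reach_mass _ _ _ D_sum1) mul1r.
  by rewrite sumr_const -[_ *+ #|_|]mulr_natl mulrA.
have stepTV t : (t < m)%N ->
  \sum_v `|E (fun i => trunc t.+1 i v) - p t.+1 v|
    <= \sum_v `|E (fun i => trunc t i v) - p t v|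
       + (s / 2 + K ^+ 2 / (2 * s * M))
       + 2 * K * (L^-1 + #|V|%:R * 4 / K ^+ q.+1).
  move=> tm; set u := fun v => E (fun i => trunc t i v).
  pose r v x := E (fun i => trunc t i v * chi i x).
  have EF w : E (fun i => F t i w)
      = \sum_(e : V * X | step e.1 e.2 == w) D e.2 * (u e.1 + r e.1 e.2).
    rewrite ave_sum; apply: eq_bigr => e _; rewrite -aveD -aveZ.
    by apply: eq_ave => i _; rewrite /biased; ring.
  (* Three sources of error: the inherited one, the bias [r] of the next sample, and the new cut. *)
  have pw w : `|E (fun i => trunc t.+1 i w) - p t.+1 w|
      <= \sum_(e : V * X | step e.1 e.2 == w)
            D e.2 * (`|u e.1 - p t e.1| + `|r e.1 e.2|)
         + E (fun i => F t i w - trunc t.+1 i w).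
    have -> : E (fun i => trunc t.+1 i w) - p t.+1 w
      = (E (fun i => F t i w) - p t.+1 w)
        + (-1) * E (fun i => F t i w - trunc t.+1 i w).
      rewrite -aveZ addrAC -aveD; congr (_ - _); apply: eq_ave => i _; ring.
    apply: le_trans (ler_normD _ _) _; apply: lerD; last first.
      rewrite normrM normrN1 mul1r ger0_norm // ave_ge0 // => i _.
      by rewrite subr_ge0 /= ge_min lexx.
    rewrite EF reachS /push -sumrB; apply: le_trans (ler_norm_sum _ _ _) _.
    apply: ler_sum => e _; rewrite -mulrBr normrM ger0_norm // ler_wpM2l //.
    by rewrite addrAC ler_normD.
  apply: le_trans (ler_sum _ (fun w _ => pw w)) _.
  rewrite big_split /= lerD ?loss //.
  rewrite (_ : \sum_w _ = \sum_v \sum_x D x * (`|u v - p t v| + `|r v x|)).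
  2: by rewrite pair_bigA [RHS](partition_big (fun e : V * X => step e.1 e.2) predT).
  have -> : \sum_v `|u v - p t v| + (s / 2 + K ^+ 2 / (2 * s * M))
     = \sum_v (`|u v - p t v| + p t v * (s / 2 + K ^+ 2 / (2 * s * M))).
    by rewrite big_split /= -mulr_suml (reach_mass _ _ _ D_sum1) mul1r.
  apply: ler_sum => v _; under eq_bigr do rewrite mulrDr.
  rewrite big_split /= -mulr_suml D_sum1 mul1r lerD2l.
  have := p_ge0 t v; rewrite le_eqVlt => /orP[/eqP pz|pp].
    rewrite -pz mul0r big1 // => x _.
    rewrite /r (eq_ave (w := fun=> 0)) ?ave_cst ?normr0 ?mulr0 // => i _.
    by rewrite truncE -pz !mul0r.
  (* Scaling the AM-GM parameter by [p t v] makes the bound proportional to [p t v], so that it sums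
     to a constant over the vertices. *)
  have -> : p t v * (s / 2 + K ^+ 2 / (2 * s * M))
      = (s * p t v) / 2 + (K * p t v) ^+ 2 / (2 * (s * p t v) * M).
    by field; rewrite (gt_eqF s0') (gt_eqF M0) (gt_eqF pp).
  apply: ave_norm_le; first by rewrite mulr_gt0.
  by move=> i _; rewrite trunc_ge0 trunc_le.
have stepL t : (t < m)%N ->
  \sum_v E (fun i => f i t.+1 v - trunc t.+1 i v)
    <= \sum_v E (fun i => f i t v - trunc t i v)
       + 2 * K * (L^-1 + #|V|%:R * 4 / K ^+ q.+1).
  move=> tm; rewrite -ave_sum.
  rewrite (eq_ave (w := fun i => \sum_v (f i t v - trunc t i v)
     + \sum_v (F t i v - trunc t.+1 i v))).
    by rewrite aveD !ave_sum lerD2l loss.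
  (* Reading a sample preserves mass, so the deficit grows by exactly what is cut. *)
  move=> i iH; rewrite !sumrB !reachS (push_mass _ _ (biased_sum1 iH)).
  by rewrite (push_mass _ _ (biased_sum1 iH)); ring.
have ind t : (t <= m)%N ->
  \sum_v `|E (fun i => trunc t i v) - p t v|
   + \sum_v E (fun i => f i t v - trunc t i v) <= t%:R * drift s L q.
  elim: t => [|t IH] tm.
    rewrite mul0r !big1 ?addr0 // => v _ /=.
      rewrite (eq_ave (w := fun=> 0)) ?ave_cst // => i _.
      by rewrite reach0 subrr.
    by rewrite ave_cst // reach0 subrr normr0.
  have := IH (ltnW tm); have := stepTV t tm; have := stepL t tm.
  have -> : t.+1%:R * drift s L q = t%:R * drift s L q + drift s L q.
    by rewrite -[t.+1%:R]natr1 mulrDl mul1r.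
  set d := t%:R * _; rewrite /drift.
  set a := _ + K ^+ 2 / _; set b := L^-1 + _; lra.
apply: le_trans (ind m (leqnn m)); rewrite -big_split /=; apply: ler_sum => v _.
have -> : E (fun i => f i m v) - p m v
   = (E (fun i => trunc m i v) - p m v) + E (fun i => f i m v - trunc m i v).
  have -> : E (fun i => f i m v)
    = E (fun i => trunc m i v) + E (fun i => f i m v - trunc m i v).
    by rewrite -aveD; apply: eq_ave => i _; rewrite addrC subrK.
  ring.
apply: le_trans (ler_normD _ _) _; rewrite lerD2l ger0_norm // ave_ge0 // => i _.
by rewrite subr_ge0 trunc_le_reach.
Qed.

End HiddenBias.

(** * Acceptance probability as a sum over final vertices *)

Section IidReach.
Variables (R : realType) (X V : finType) (step : V -> X -> V).
Variables (D : X -> R) (A : pred V).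

Let val r v := iid_prob D (fun u : r.-tuple X => A (foldl step v u)).

Lemma iid_prob0 v : val 0 v = (A v)%:R.
Proof.
rewrite /val /iid_prob big_mkcond (bigD1 [tuple]) //= big_ord0.
by rewrite big1 ?addr0 => [|u /eqP[]]; [case: (A v) | rewrite tuple0].
Qed.

Lemma iid_probS r v : val r.+1 v = \sum_x D x * val r (step v x).
Proof.
rewrite /val /iid_prob big_mkcond /=.
under [RHS]eq_bigr do rewrite big_mkcond mulr_sumr.
rewrite pair_bigA (reindex (fun e : X * r.-tuple X => cons_tuple e.1 e.2)) /=.
  apply: eq_bigr => -[x u] _ /=; case: ifP => _; last by rewrite mulr0.
  rewrite big_ord_recl tnth0; congr (_ * _); apply: eq_bigr => i _.
  by rewrite tnthS.
exists (fun u => (thead u, [tuple of behead u])) => [[x u] _|u _] /=.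
  by congr pair; apply: val_inj.
by rewrite [RHS]tuple_eta; apply: val_inj.
Qed.

Lemma iid_prob_reach m s0 :
  iid_prob D (fun u : m.-tuple X => A (foldl step s0 u))
    = \sum_(v | A v) reach step s0 D m v.
Proof.
(* Moving one sample from the unread part of the stream to the part already read leaves the
   acceptance probability unchanged. *)
have inv r t : \sum_v reach step s0 D t v * val r v
    = \sum_v reach step s0 D (t + r) v * val 0 v.
  elim: r t => [|r IH] t; first by rewrite addn0.
  rewrite addnS -addSn -IH reachS push_sum; apply: eq_bigr => v _.
  by rewrite iid_probS mulr_sumr; apply: eq_bigr => x _; rewrite mulrCA mulrA.
have := inv m 0; rewrite add0n (bigD1 s0) //= reach0 eqxx mul1r big1.
  move=> h; rewrite addr0 in h; rewrite -/(val m s0) h [RHS]big_mkcond.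
  apply: eq_bigr => v _; rewrite iid_prob0.
  by case: (A v); rewrite ?mulr1 ?mulr0.
by move=> v /negbTE vs; rewrite reach0 vs mul0r.
Qed.

End IidReach.

(** * Counting subspaces over the field with two elements *)

Section Subspaces.
Variable n : nat.
Local Notation Fn := 'rV['F_2]_n.
Implicit Types (W U : {vspace Fn}) (S T : {set Fn}).

Lemma subspacesP k S :
  reflect (exists2 W : {vspace Fn}, \dim W = k & S = [set v in W])
          (S \in subspaces k n).
Proof. by rewrite inE; apply: asboolP. Qed.

Lemma card_vspace_set W : #|[set v in W]| = (2 ^ \dim W)%N.
Proof. by rewrite cardsE card_vspace card_Fp. Qed.

Lemma card_subspace k S : S \in subspaces k n -> #|S| = (2 ^ k)%N.
Proof. by case/subspacesP => W <- ->; apply: card_vspace_set. Qed.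

Lemma vspace_setS W U : ([set v in W] \subset [set v in U]) = (W <= U)%VS.
Proof.
apply/fintype.subsetP/subvP => h v; last by rewrite !inE; apply: h.
by have := h v; rewrite !inE.
Qed.

Definition hyperplanes k T : {set {set Fn}} :=
  [set S in subspaces k n | S \subset T].

Definition covers k S : {set {set Fn}} :=
  [set T in subspaces k.+1 n | S \subset T].

(** Distinct hyperplanes together span [T], so the dimension formula gives their intersection
    codimension 2 in [T]. *)
Lemma card_hyperplaneI k T S1 S2 : T \in subspaces k.+1 n ->
    S1 \in hyperplanes k T -> S2 \in hyperplanes k T -> S1 != S2 ->
  (#|S1 :&: S2| * 4)%N = #|T|.
Proof.
case/subspacesP => W dW ->.
rewrite !inE => /andP[/asboolP[W1 d1 ->] s1] /andP[/asboolP[W2 d2 ->] s2] ne.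
rewrite !vspace_setS in s1 s2.
have -> : [set v in W1] :&: [set v in W2] = [set v in (W1 :&: W2)%VS].
  by apply/finset.setP => v; rewrite !inE memv_cap.
rewrite !card_vspace_set.
have sW : (W1 + W2 <= W)%VS by rewrite subv_add s1 s2.
have := dimvS sW; have := dimvS (addvSl W1 W2).
have := dimv_sum_cap W1 W2; rewrite dW d1 d2.
case: (ltngtP (\dim (W1 + W2)) k.+1) => [lt|//|-> h _ _].
  move=> _ h1 _; case/eqP: ne; suff -> : W1 = W2 by [].
  have e1 : W1 = (W1 + W2)%VS.
    by apply/eqP; rewrite eqEdim addvSl /= d1.
  have e2 : W2 = (W1 + W2)%VS.
    by apply/eqP; rewrite eqEdim addvSr /= d2.
  exact: etrans e1 (esym e2).
have -> : k.+1 = (\dim (W1 :&: W2)).+2 by lia.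
by rewrite !expnS; lia.
Qed.

(** Double counting of vectors outside [S]: a cover contains [2 ^ k] of them, and each such [x] lies
    in the single cover [W + <[x]>]. *)
Lemma card_covers k S : S \in subspaces k n ->
  (#|covers k S| * 2 ^ k + 2 ^ k = 2 ^ n)%N.
Proof.
move=> Sk; have cS := card_subspace Sk; case/subspacesP: (Sk) => W dW SW.
have -> : (#|covers k S| * 2 ^ k = #|~: S|)%N.
  transitivity (\sum_(T in covers k S) \sum_(x in ~: S) (x \in T))%N.
    rewrite -sum_nat_const; apply: eq_bigr => T.
    rewrite inE => /andP[Tk ST].
    have -> : (\sum_(x in ~: S) (x \in T) = #|T :\: S|)%N.
      rewrite -sum1_card big_mkcond [RHS]big_mkcond; apply: eq_bigr => x _.
      by rewrite !inE; case: (x \in S); case: (x \in T).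
    rewrite cardsD (finset.setIidPr ST) cS (card_subspace Tk) expnS.
    by rewrite mul2n -addnn addnK.
  rewrite exchange_big -sum1_card; apply: eq_bigr => x.
  rewrite inE => xS; pose T0 := [set v in (W + <[x]>)%VS].
  have xW : x \notin W by move: xS; rewrite SW inE.
  have dT0 : \dim (W + <[x]>) = k.+1.
    rewrite dimv_disjoint_sum ?dW ?dim_vline ?addn1.
      by case: eqVneq xW => [->|]; rewrite ?mem0v // addn1.
    apply/eqP; rewrite -subv0; apply/subvP => y.
    rewrite memv_cap => /andP[yW /vlineP[c yx]]; rewrite yx memv0.
    case: (eqVneq c 0) => [->|c0]; first by rewrite scale0r eqxx.
    by move: yW; rewrite yx => /(memvZ c^-1); rewrite scalerA mulVf // scale1r (negbTE xW).
  rewrite (bigD1 T0) /=; last first.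
    rewrite inE SW vspace_setS addvSl andbT; apply/subspacesP.
    by exists (W + <[x]>)%VS.
  rewrite inE (subvP (addvSr W <[x]>)) ?memv_line // big1 // => T.
  rewrite inE => /andP[/andP[/subspacesP[U dU TU] ST] TT0].
  case xT: (x \in T) => //; case/eqP: TT0; rewrite TU.
  suff -> : U = (W + <[x]>)%VS by [].
  apply/esym/eqP; rewrite eqEdim dU dT0 leqnn andbT subv_add.
  by rewrite -vspace_setS -SW -TU ST -memvE; move: xT; rewrite TU inE.
by rewrite -cS addnC cardsC card_mx card_Fp // mul1n.
Qed.

Definition perp S : {set Fn} := [set y | [forall x in S, x *m y^T == 0]].

(** [perp S] is the kernel of the transposed basis matrix, which has rank [\dim W]. *)
Lemma card_perp k S : S \in subspaces k n -> (#|perp S| * 2 ^ k = 2 ^ n)%N.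
Proof.
case/subspacesP => W <- ->.
pose B : 'M['F_2]_(\dim W, n) := \matrix_i (vbasis W)`_i.
have mulB (v : 'rV_(\dim W)) : v *m B = \sum_i v 0 i *: (vbasis W)`_i.
  by rewrite mulmx_sum_row; apply: eq_bigr => i _; rewrite rowK.
have fB : row_free B.
  apply: inj_row_free => v; rewrite mulB => h.
  apply/rowP => i; rewrite [RHS]mxE.
  exact: (freeP (basis_free (vbasisP W)) (v 0) h i).
have -> : perp [set v in W] = rowg (kermx B^T).
  apply/finset.setP => y; rewrite !inE sub_kermx -trmx_eq0 trmx_mul trmxK.
  apply/forall_inP/eqP => [h|h x].
    apply/row_matrixP => i; rewrite row_mul rowK row0; apply/eqP/h.
    by rewrite inE vbasis_mem // mem_nth // size_tuple.
  rewrite inE => /coord_vbasis ->; apply/eqP.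
  rewrite (_ : \sum_i _ = (\row_i coord (vbasis W) i x) *m B).
    by rewrite -mulmxA h mulmx0.
  by rewrite mulB; apply: eq_bigr => i _; rewrite mxE.
rewrite card_rowg card_Fp // mxrank_ker mxrank_tr (eqP fB) -expnD subnK //.
by rewrite -(eqP fB) rank_leq_col.
Qed.

Lemma perpP y S : reflect {in S, forall x, x *m y^T = 0} (y \in perp S).
Proof.
by rewrite inE; apply: (iffP forall_inP) => h x xS; apply/eqP; rewrite h.
Qed.

(* Each vector outside [perp T] has exactly one hyperplane of [T] orthogonal to
   it, namely the kernel on [T] of the functional it defines. *)
Lemma card_hyperplanes k T : T \in subspaces k.+1 n ->
  #|hyperplanes k T|.+1 = (2 ^ k.+1)%N.
Proof.
move=> Tk; have cT := card_perp Tk; case/subspacesP: (Tk) => W dW TW.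
set a := #|perp T| in cT.
have a0 : (0 < a)%N by have := expn_gt0 2 n; rewrite -cT muln_gt0 => /andP[].
have pST S : S \subset T -> perp T \subset perp S.
  move=> ST; apply/fintype.subsetP => y /perpP h; apply/perpP => x xS.
  by apply: h; apply: (fintype.subsetP ST).
suff h : (#|hyperplanes k T| * a = #|~: perp T|)%N.
  apply/eqP; rewrite -(eqn_pmul2r a0) [(2 ^ _ * _)%N]mulnC cT mulSn h.
  by rewrite cardsC card_mx card_Fp // mul1n.
transitivity (\sum_(S in hyperplanes k T) \sum_(y in ~: perp T) (y \in perp S))%N.
  rewrite -sum_nat_const; apply: eq_bigr => S.
  rewrite inE => /andP[Sk ST].
  have -> : (\sum_(y in ~: perp T) (y \in perp S) = #|perp S :\: perp T|)%N.
    rewrite -sum1_card big_mkcond [RHS]big_mkcond; apply: eq_bigr => y _.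
    by rewrite !finset.in_setD finset.in_setC; case: (y \in perp T); case: (y \in perp S).
  rewrite cardsD (finset.setIidPr (pST _ ST)) -/a.
  suff -> : #|perp S| = (a * 2)%N by rewrite muln2 -addnn addnK.
  apply/eqP; rewrite -(eqn_pmul2r (_ : 0 < 2 ^ k)%N) ?expn_gt0 //.
  by rewrite (card_perp Sk) -cT expnS mulnA.
rewrite exchange_big -sum1_card; apply: eq_bigr => y; rewrite finset.in_setC => yT.
pose phi : 'Hom(Fn, 'M['F_2]_(1, 1)) := linfun (mulmxr y^T).
have phiE x : phi x = x *m y^T by rewrite lfunE.
(* As [y] is not in [perp T], [phi] maps [W] onto its one-dimensional target; rank-nullity gives the
   rest. *)
have dI : \dim (W :&: lker phi) = k.
  have := limg_ker_dim phi W; rewrite dW.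
  suff -> : \dim (phi @: W) = 1%N by rewrite addn1 => -[].
  apply/eqP; rewrite eqn_leq (leq_trans (dimvS (subvf _))) ?dimvf //=.
  rewrite lt0n dimv_eq0; apply: contraNN yT => /eqP W0.
  apply/perpP => x; rewrite TW inE => xW.
  by apply/eqP; rewrite -phiE -memv0 -W0 memv_img.
pose S0 := [set v in (W :&: lker phi)%VS].
have S0y : y \in perp S0.
  by apply/perpP => x; rewrite inE memv_cap memv_ker phiE => /andP[_ /eqP].
rewrite (bigD1 S0) /=; last first.
  rewrite inE TW vspace_setS capvSl andbT; apply/subspacesP.
  by exists (W :&: lker phi)%VS.
rewrite S0y big1 // => S; rewrite inE => /andP[/andP[/subspacesP[U dU SU] ST] SS0].
case yS: (y \in perp S) => //; case/eqP: SS0; rewrite SU.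
suff -> : U = (W :&: lker phi)%VS by [].
apply/eqP; rewrite eqEdim dU dI leqnn andbT subv_cap.
rewrite -vspace_setS -SU -TW ST /=; apply/subvP => x xU.
by rewrite memv_ker phiE; apply/eqP/(perpP _ _ yS); rewrite SU inE.
Qed.

End Subspaces.

(** * Hyperplanes as orthonormal functions *)

Section HyperplaneCharacters.
Variables (R : realType) (n k : nat) (T : {set 'rV['F_2]_n}).
Implicit Types S : {set 'rV['F_2]_n}.
Hypothesis T_dim : T \in subspaces k.+1 n.
Local Notation H := (hyperplanes k T).

(** On [T], for a hyperplane [S] of [T], this is the nontrivial additive character with kernel
    [S]. *)
Definition side (S : {set 'rV['F_2]_n}) (x : 'rV['F_2]_n) : R :=
  if x \in S then 1 else -1.

Lemma sideE S x : side S x = 2 * (x \in S)%:R - 1.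
Proof. by rewrite /side; case: (x \in S); rewrite /=; lra. Qed.

Lemma sum_D1 (A : {set 'rV['F_2]_n}) : A \subset T ->
  \sum_x D1 R T x * (x \in A)%:R = #|A|%:R / #|T|%:R.
Proof.
move=> AT; rewrite -sum1_card natr_sum mulr_suml [RHS]big_mkcond /=.
apply: eq_bigr => x _; rewrite /D1 /uniform_pmf.
case xA: (x \in A); last by rewrite mulr0.
by rewrite (fintype.subsetP AT) // mulr1 mul1r.
Qed.

Lemma card_T_gt0 : 0 < #|T|%:R :> R.
Proof. by rewrite (card_subspace T_dim) ltr0n expn_gt0. Qed.

Lemma D1_ge0 S x : 0 <= D1 R S x.
Proof. by rewrite /D1 /uniform_pmf; case: ifP; rewrite ?invr_ge0. Qed.

Lemma D1_sum1 : \sum_x D1 R T x = 1.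
Proof.
have := sum_D1 (fintype.subxx T); rewrite divff ?gt_eqF ?card_T_gt0 // => <-.
apply: eq_bigr => x _; rewrite /D1 /uniform_pmf.
by case: (x \in T); rewrite ?mulr1 ?mulr0.
Qed.

Lemma hyperplane_sub S : S \in H -> S \subset T.
Proof. by rewrite inE => /andP[]. Qed.

Lemma hyperplane_half S : S \in H -> #|T|%:R = 2 * #|S|%:R :> R.
Proof.
rewrite inE => /andP[Sk _]; rewrite (card_subspace T_dim) (card_subspace Sk).
by rewrite expnS natrM.
Qed.

Lemma side_le1 S x : -1 <= side S x <= 1.
Proof. by rewrite /side; case: ifP => _; lra. Qed.

Lemma side_mean S : S \in H -> \sum_x D1 R T x * side S x = 0.
Proof.
move=> SH; transitivity (\sum_x (2 * (D1 R T x * (x \in S)%:R) - D1 R T x)).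
  by apply: eq_bigr => x _; rewrite sideE; ring.
rewrite sumrB -mulr_sumr D1_sum1 (sum_D1 (hyperplane_sub SH)).
have := card_T_gt0; rewrite (hyperplane_half SH) => S0.
by field; lra.
Qed.

(** Expanding the signs into indicators, each hyperplane has half of [T] and two distinct ones share
    a quarter. *)
Lemma side_orth S1 S2 : S1 \in H -> S2 \in H ->
  \sum_x D1 R T x * (side S1 x * side S2 x) = (S1 == S2)%:R.
Proof.
move=> H1 H2; have [->|ne] := eqVneq S1 S2.
  rewrite -[RHS]D1_sum1; apply: eq_bigr => x _.
  by rewrite /side; case: ifP => _; ring.
transitivity (\sum_x (4 * (D1 R T x * (x \in S1 :&: S2)%:R)
   - 2 * (D1 R T x * (x \in S1)%:R) - 2 * (D1 R T x * (x \in S2)%:R)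
   + D1 R T x)).
  apply: eq_bigr => x _; rewrite !sideE finset.in_setI.
  by case: (x \in S1); case: (x \in S2) => /=; ring.
rewrite !big_split /= !sumrN -!mulr_sumr D1_sum1.
have I12 : S1 :&: S2 \subset T by rewrite finset.subIset ?hyperplane_sub.
rewrite (sum_D1 I12) !(sum_D1 (hyperplane_sub _)) //.
have := card_T_gt0.
have := hyperplane_half H2; have := hyperplane_half H1.
have : #|S1 :&: S2|%:R * 4 = #|T|%:R :> R.
  by rewrite -(card_hyperplaneI T_dim H1 H2 ne) natrM.
set t := #|T|%:R; set a := #|_|%:R; set b := #|_|%:R; set c := #|_|%:R.
move=> ta tb tc t0.
have -> : a = t / 4 by lra.
have -> : b = t / 2 by lra.
have -> : c = t / 2 by lra.
by field; lra.
Qed.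

Lemma D1_hyperplane S : S \in H -> D1 R S = biased (D1 R T) side S.
Proof.
move=> SH; apply/funext => x.
rewrite /biased sideE /D1 /uniform_pmf; have := card_T_gt0.
rewrite (hyperplane_half SH) => S0.
case xS: (x \in S); last by rewrite /= mulr0 addrC subrK mulr0.
rewrite (fintype.subsetP (hyperplane_sub SH)) //=; field; lra.
Qed.

End HyperplaneCharacters.

(** * One hybrid step for a branching program *)

Section Hybrid.
Variables (R : realType) (n m d : nat) (B : branching_program 'rV['F_2]_n m d).
Local Notation V := (bp_vertex B).

Definition accepting : pred V := fun v => if bp_node v is inl c then c else false.

Definition accept_prob S : R :=
  iid_prob (D1 R S) (fun u : m.-tuple 'rV['F_2]_n => bp_output B u).

Lemma accept_probE S :
  accept_prob S = \sum_(v | accepting v) reach (@bp_step _ _ _ B) (bp_start B) (D1 R S) m v.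
Proof. by rewrite -iid_prob_reach. Qed.

Lemma card_bp_vertex : (#|V| <= m.+1 * d)%N.
Proof.
rewrite -sum1_card (partition_big (@bp_layer _ _ _ B) predT) //=.
rewrite -[X in (_ <= X * _)%N]card_ord -sum_nat_const.
apply: leq_sum => i _; have := @bp_width _ _ _ B i.
by rewrite -sum1dep_card.
Qed.

(** Acceptance is a set of final vertices, so the gap is at most the L1 distance of the vertex
    distributions. *)
Lemma hyperplane_gap k T q (K s L : R) :
    T \in subspaces k.+1 n -> 1 <= K -> 0 < s -> 0 < L ->
    (4 ^+ q.+1 * (L * K) / #|hyperplanes k T|%:R) *+ m <= 2^-1 ->
  `|ave (hyperplanes k T) accept_prob - accept_prob T|
    <= m%:R * drift V (hyperplanes k T) K s L q.
Proof.
move=> Tk K1 s0 L0 eta_le.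
have H0 : (0 < #|hyperplanes k T|)%N.
  by have := card_hyperplanes Tk; rewrite expnS; have := expn_gt0 2 k; lia.
have := total_variation_le (@bp_step _ _ _ B) (bp_start B) (@D1_ge0 R n T)
  (D1_sum1 R Tk) H0 (@side_le1 R n) (side_mean R Tk) (side_orth R Tk) K1 s0 L0
  eta_le.
apply: le_trans.
rewrite (eq_ave (w := fun S => \sum_(v | accepting v)
   reach (@bp_step _ _ _ B) (bp_start B) (biased (D1 R T) (@side R n) S) m v)).
  rewrite ave_sum accept_probE -sumrB; apply: le_trans (ler_norm_sum _ _ _) _.
  by rewrite [leRHS](bigID accepting) /= lerDl sumr_ge0.
by move=> S SH; rewrite accept_probE (D1_hyperplane R Tk SH).
Qed.

End Hybrid.

(** * A random hyperplane of a random subspace *)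

Lemma ave_fiber (R : realFieldType) (I J : finType) (A : {set I}) (B : {set J})
    (r : I -> J -> bool) (u h : nat) (F : I -> R) :
    (0 < #|A|)%N -> (0 < #|B|)%N -> (0 < h)%N ->
    {in A, forall i, #|[set j in B | r i j]| = u} ->
    {in B, forall j, #|[set i in A | r i j]| = h} ->
  ave B (fun j => ave [set i in A | r i j] F) = ave A F.
Proof.
move=> A0 B0 h0 cu ch.
(* Counting related pairs in two ways. Hence each [i] receives total weight
   [u / (h * #|B|) = 1 / #|A|]. *)
have uh : (#|A| * u = #|B| * h)%N.
  rewrite -!sum_nat_const -(eq_bigr _ cu) -(eq_bigr _ ch).
  under eq_bigr do rewrite -sum1_card; under [RHS]eq_bigr do rewrite -sum1_card.
  rewrite (exchange_big_dep (mem B)) /=; last by move=> i j _; rewrite inE => /andP[].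
  by apply: eq_bigr => j jB; apply: eq_bigl => i; rewrite !inE jB.
have R0 x : (0 < x)%N -> x%:R != 0 :> R by rewrite pnatr_eq0 -lt0n.
transitivity ((\sum_(j in B) \sum_(i in [set i in A | r i j]) F i)
   / (h%:R * #|B|%:R)).
  rewrite invfM mulrA mulr_suml /ave; congr (_ / _).
  by apply: eq_bigr => j jB; rewrite (ch j jB).
rewrite (exchange_big_dep (mem A)) /=; last by move=> i j _; rewrite inE => /andP[].
transitivity ((\sum_(i in A) F i * u%:R) / (h%:R * #|B|%:R)).
  congr (_ / _); apply: eq_bigr => i iA.
  rewrite sumr_const [RHS]mulr_natr; congr (_ *+ _); rewrite -(cu i iA).
  by apply: eq_card => j; rewrite !inE unfold_in /= inE iA.
rewrite -mulr_suml /ave -natrM mulnC -uh natrM.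
have u0 : (0 < u)%N.
  by have := muln_gt0 #|B| h; rewrite -uh B0 h0 muln_gt0 => /andP[].
by field; rewrite !R0.
Qed.

(** Descend from the whole space, taking a hyperplane at each stage. *)
Lemma subspaces_gt0 k n : (k <= n)%N -> (0 < #|subspaces k n|)%N.
Proof.
move=> kn; rewrite -(subKn kn); elim: (n - k)%N => [|j IH].
  rewrite subn0; apply/card_gt0P; exists [set v in {:'rV['F_2]_n}]%VS.
  by apply/subspacesP; exists fullv; rewrite // dimvf /dim /= mul1n.
have [nj|jn] := leqP n j.
  by have -> : (n - j.+1 = n - j)%N by lia.
move: IH; have -> : (n - j = (n - j.+1).+1)%N by lia.
move=> /card_gt0P[T Tk]; have := card_hyperplanes Tk.
have : (0 < #|hyperplanes (n - j.+1) T|)%N.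
  have := card_hyperplanes Tk; rewrite expnS; have := expn_gt0 2 (n - j.+1); lia.
by case/card_gt0P => S; rewrite inE => /andP[Sk _] _; apply/card_gt0P; exists S.
Qed.

(** Inclusion is biregular: the numbers of covers and of hyperplanes depend on the dimensions
    only. *)
Lemma ave_hyperplanes (R : realFieldType) n k (F : {set 'rV['F_2]_n} -> R) :
    (k < n)%N ->
  ave (subspaces k.+1 n) (fun T => ave (hyperplanes k T) F)
    = ave (subspaces k n) F.
Proof.
move=> kn; apply: (ave_fiber (r := fun S T : {set _} => S \subset T)
   (u := (2 ^ (n - k)).-1) (h := (2 ^ k.+1).-1)).
- exact: subspaces_gt0 (ltnW kn).
- exact: subspaces_gt0.
- by rewrite expnS; have := expn_gt0 2 k; lia.
- move=> S Sk; have := card_covers Sk; rewrite -/(covers k S).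
  rewrite -[X in (_ = 2 ^ X)%N](subnK (ltnW kn)) expnD -mulSnr => /eqP.
  by rewrite eqn_pmul2r ?expn_gt0 // => /eqP <-.
by move=> T Tk; rewrite -(card_hyperplanes Tk).
Qed.

(** * Choice of parameters and the chain of hybrids *)

Section Calibration.
Variables (R : realType) (n m b e : nat).
Variable B : branching_program 'rV['F_2]_n m (2 ^ b)%N.
Hypotheses (e_ge8 : (8 <= e)%N) (b_le : (b <= e ^ 2)%N) (m_le : (m <= 2 ^ e)%N).

(** With [a = 2 ^ e], take [K = a^2], [L = a^6], [s = a^-4] and exponent [Q = e], written [e.-1.+1].
    Then [4 ^ Q = a^2] and [K ^ Q = 2^(2 e^2)], against at most [2 a 2^(e^2)] vertices. The terms of
    [drift] are at most [1/2], [1/2], [4] and [1] times [a^-4], and there are [m <= a] steps. *)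
Lemma hyperplane_gap_le k T : (16 * e <= k)%N -> T \in subspaces k.+1 n ->
  `|ave (hyperplanes k T) (accept_prob R B) - accept_prob R B T|
    <= 6 / (2 ^ e)%:R ^+ 3.
Proof.
move=> ek Tk; pose a : R := (2 ^ e)%:R.
have aX : a = 2 ^+ e by rewrite /a natrX.
have a256 : 256 <= a.
  by rewrite aX (_ : 256 = 2 ^+ 8) ?ler_weXn2l ?ler1n // -natrX.
have a0 : 0 < a by lra.
have a1 : 1 <= a by lra.
have H0 : (2 ^ k <= #|hyperplanes k T|)%N.
  have := card_hyperplanes Tk; rewrite expnS; have := expn_gt0 2 k; lia.
set M : R := #|hyperplanes k T|%:R.
have Ma : a ^+ 16 <= M.
  rewrite aX -exprM -natrX ler_nat (leq_trans _ H0) // leq_exp2l //; lia.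
have M0 : 0 < M by apply: lt_le_trans Ma; rewrite exprn_gt0.
have ma : m%:R <= a by rewrite ler_nat.
have e0 : (0 < e)%N by lia.
have q4 : 4 ^+ e.-1.+1 = a ^+ 2.
  by rewrite prednK // aX -exprM mulnC exprM expr2 -natrM.
have K1 : 1 <= a ^+ 2 by rewrite exprn_ege1.
have s0 : 0 < (a ^+ 4)^-1 by rewrite invr_gt0 exprn_gt0.
have L0 : 0 < a ^+ 6 by rewrite exprn_gt0.
have etaM : (4 ^+ e.-1.+1 * (a ^+ 6 * a ^+ 2) / M) *+ m <= 2^-1.
  rewrite q4 -!exprD -mulr_natr mulrAC ler_pdivrMr //.
  apply: (@le_trans _ _ (a ^+ 10 * a)); first by rewrite ler_pM2l ?exprn_gt0.
  rewrite -exprSr; have : a ^+ 11 * 256 <= a ^+ 12.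
    by rewrite [leRHS]exprSr ler_pM2l ?exprn_gt0.
  have : a ^+ 12 <= a ^+ 16 by rewrite ler_weXn2l.
  have : 0 < a ^+ 11 by rewrite exprn_gt0.
  lra.
have := @hyperplane_gap R n m _ B k T e.-1 _ _ _ Tk K1 s0 L0 etaM.
move/le_trans; apply.
suff dr : drift (bp_vertex B) (hyperplanes k T) (a ^+ 2) (a ^+ 4)^-1 (a ^+ 6) e.-1
    <= 6 / a ^+ 4.
  have -> : 6 / a ^+ 3 = a * (6 / a ^+ 4) by field; lra.
  apply: le_trans (ler_wpM2l (ler0n _ m) dr) _.
  by rewrite ler_pM2r // divr_gt0 // exprn_gt0.
rewrite /drift -/M prednK //.
set N : R := #|_|%:R.
have N2 : N <= 2 * a * 2 ^+ (e ^ 2).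
  apply: (@le_trans _ _ (m.+1 * 2 ^ b)%N%:R); first by rewrite ler_nat card_bp_vertex.
  rewrite natrM ler_pM //; first by rewrite -natr1; lra.
  by rewrite natrX ler_weXn2l ?ler1n.
have N0 : 0 <= N by [].
have KE : (a ^+ 2) ^+ e = 2 ^+ (e ^ 2) * 2 ^+ (e ^ 2).
  by rewrite aX -!exprM -exprD addnn -muln2 -mulnn mulnAC mulnA.
set z : R := 2 ^+ (e ^ 2) in N2 KE.
have z8 : a ^+ 8 <= z.
  by rewrite aX /z -exprM -mulnn ler_weXn2l ?ler1n ?leq_pmul2l.
have z0 : 0 < z by rewrite exprn_gt0.
have r0 : 0 < (a ^+ 4)^-1 by [].
have h2 : (a ^+ 2) ^+ 2 / (2 * (a ^+ 4)^-1 * M) <= (a ^+ 4)^-1 / 2.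
  have -> : (a ^+ 2) ^+ 2 / (2 * (a ^+ 4)^-1 * M) = a ^+ 12 / M * ((a ^+ 4)^-1 / 2).
    by field; rewrite !gt_eqF.
  apply: ler_piMl; first by rewrite divr_ge0 // ltW.
  rewrite ler_pdivrMr // mul1r.
  by apply: le_trans Ma; rewrite ler_weXn2l.
(* The left side is at most [32 a^3 / z]; now [z >= a^8] and [a >= 256] suffice. *)
have h4 : 4 * a ^+ 2 * (N * 4 / (z * z)) <= (a ^+ 4)^-1.
  apply: (@le_trans _ _ (32 * a ^+ 3 / z)).
    have -> : 32 * a ^+ 3 / z = 16 * a ^+ 2 / (z * z) * (2 * a * z).
      by field; rewrite gt_eqF.
    have -> : 4 * a ^+ 2 * (N * 4 / (z * z)) = 16 * a ^+ 2 / (z * z) * N.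
      by field; rewrite gt_eqF.
    by rewrite ler_wpM2l // divr_ge0 ?mulr_ge0 ?exprn_ge0 // ltW.
  rewrite ler_pdivrMr // ler_pdivlMl ?exprn_gt0 //.
  apply: le_trans z8; have -> : a ^+ 8 = a ^+ 7 * a by rewrite exprSr.
  have -> : a ^+ 4 * (32 * a ^+ 3) = a ^+ 7 * 32 by ring.
  by rewrite ler_pM2l ?exprn_gt0 //; lra.
have h3 : 4 * a ^+ 2 * (a ^+ 6)^-1 = 4 * (a ^+ 4)^-1 by field; lra.
rewrite KE mulrDr h3; set c := (a ^+ 4)^-1 in r0 h2 h4 *; lra.
Qed.

Local Notation mean_accept k := (ave (subspaces k n) (accept_prob R B)).

(** Telescoping over the dimension: [ave_hyperplanes] turns each increment into an average over [T]
    of gaps bounded by [hyperplane_gap_le]. *)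
Lemma ave_subspaces_gap_le k i : (16 * e <= k)%N -> (k + i <= n)%N ->
  `|mean_accept k - mean_accept (k + i)| <= i%:R * (6 / (2 ^ e)%:R ^+ 3).
Proof.
move=> ek; elim: i => [|i IH] kin; first by rewrite addn0 subrr normr0 mul0r.
rewrite addnS in kin *.
apply: le_trans (ler_distD (mean_accept (k + i)) _ _) _.
set c := 6 / _ in IH *; rewrite -[i.+1%:R]natr1 mulrDl mul1r.
apply: lerD; first by rewrite IH // ltnW.
rewrite -(ave_hyperplanes _ kin).
set A := subspaces _ _; set u := fun T => _; set w := accept_prob R B.
have A0 : (0 < #|A|)%N by apply: subspaces_gt0.
have -> : ave A u - ave A w = ave A (fun T => u T - w T).
  rewrite -mulN1r -aveZ -aveD; apply: eq_ave => T _; ring.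
have uw : {in A, forall T, `|u T - w T| <= c}.
  by move=> T TA; apply: hyperplane_gap_le => //; apply: leq_trans (leq_addr _ _).
rewrite ler_norml; apply/andP; split.
  rewrite -[leLHS](ave_cst _ A0); apply: ler_ave => T /uw.
  by rewrite ler_norml => /andP[].
rewrite -[leRHS](ave_cst _ A0); apply: ler_ave => T /uw.
by rewrite ler_norml => /andP[].
Qed.

Lemma ave_subspaces_full : mean_accept n = accept_prob R B [set: _].
Proof.
rewrite -[RHS](ave_cst _ (subspaces_gt0 (leqnn n))); apply: eq_ave => T Tn.
congr accept_prob; apply/eqP; rewrite eqEcard finset.subsetT.
by rewrite (card_subspace Tn) cardsT card_mx card_Fp // mul1n leqnn.
Qed.

Lemma success_probE k :
  success_prob R k B
    = 2^-1 + (mean_accept k - accept_prob R B [set: _]) / 2.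
Proof.
have -> : success_prob R k B
    = (1 - accept_prob R B [set: _] + mean_accept k) / 2.
  congr ((_ + _) / 2); last first.
    rewrite /ave mulr_suml; apply: eq_bigr => S Sk.
    by rewrite /uniform_pmf Sk mulrC.
  rewrite accept_probE.
  rewrite (iid_prob_reach (@bp_step _ _ _ B) (@D0 R n) [pred v | ~~ accepting v] m (bp_start B)).
  have D0_sum1 : \sum_x (@D0 R n) x = 1.
    under eq_bigr do rewrite /D0 /uniform_pmf finset.in_setT.
    rewrite /= sumr_const cardsT -[_ *+ _]mulr_natl divff //.
    by rewrite pnatr_eq0 card_mx -lt0n expn_gt0 card_Fp.
  rewrite -(reach_mass (@bp_step _ _ _ B) (bp_start B) m D0_sum1).
  rewrite (_ : D1 R [set: _] = @D0 R n) // [X in X - _](bigID (@accepting _ _ _ B)) /=.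
  by rewrite addrAC subrr add0r.
lra.
Qed.

(** There are [n - k <= 2 ^ e] hybrids, each costing [6 / (2 ^ e)^3], and the success probability
    halves the total. *)
Lemma success_prob_le k : (16 * e <= k)%N -> (k <= n)%N -> (n <= 2 ^ e)%N ->
  success_prob R k B <= 2^-1 + 3 / (2 ^ e)%:R ^+ 2.
Proof.
move=> ek kn ne; rewrite success_probE lerD2l -ave_subspaces_full.
have := @ave_subspaces_gap_le k (n - k) ek; rewrite subnKC // => /(_ (leqnn n)) h.
have nk : (n - k)%:R <= (2 ^ e)%:R :> R by rewrite ler_nat; lia.
have a0 : 0 < (2 ^ e)%:R :> R by rewrite ltr0n expn_gt0.
set a : R := (2 ^ e)%:R in nk a0 h *.
have h2 : (n - k)%:R * (6 / a ^+ 3) <= 2 * (3 / a ^+ 2).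
  have -> : 2 * (3 / a ^+ 2) = a * (6 / a ^+ 3) by field; lra.
  by rewrite ler_pM2r // divr_gt0 // exprn_gt0.
by have := ler_norm (mean_accept k - mean_accept n); lra.
Qed.

End Calibration.

(** * Constants and the asymptotic statement *)

Lemma powR2_le (R : realType) (x : R) e : x <= e%:R -> 2 `^ x <= (2 ^ e)%:R :> R.
Proof.
move=> xe; rewrite natrX -powR_mulrn //.
by apply: ler_powR => //; rewrite ler1n.
Qed.

Local Open Scope classical_set_scope.
Local Open Scope ring_scope.

Theorem theorem4p1 (R : realType) :
  exists c2 : R, 0 < c2 /\
  exists alpha beta : R, [/\ 0 < alpha, 0 < beta &
  forall f : nat -> R, f =o_\oo (fun k : nat => k%:R : R) ->
  \forall k \near \oo, forall (n b m : nat)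
    (B : branching_program 'rV['F_2]_n m (2 ^ b)%N),
    c2 * ln (n%:R : R) < k%:R -> (k <= n)%N ->
    2^-1 + 2 `^ (- f k) <= success_prob R k B ->
    alpha * k%:R ^+ 2 <= b%:R \/ 2 `^ (beta * k%:R) <= m%:R].
Proof.
have ln2 : 0 < ln 2 :> R by rewrite ln_gt0 // ltr1n.
(* With this constant the assumption on [n] reads [n < 2^(k / 32)]. *)
exists (32 / ln 2); split; first by rewrite divr_gt0.
exists 400^-1, 32^-1; split; [by rewrite invr_gt0 ltr0n|by rewrite invr_gt0 ltr0n|].
move=> f /eqoP/(_ 32^-1); rewrite invr_gt0 ltr0n => /(_ isT) fk.
near=> k => n b m B nk kn succ.
have k256 : (256 <= k)%N by near: k; exact: nbhs_infty_ge.
have fkk : `|f k| <= 32^-1 * `|k%:R : R| by near: k.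
have [//|bk] := leP (400^-1 * k%:R ^+ 2) (b%:R : R); first by left.
have [//|mk] := leP (2 `^ (32^-1 * k%:R)) (m%:R : R); first by right.
(* Rounding is harmless for large [k]: [k / 32 <= e] and [k <= 17 e]. The constant 400 leaves room
   above [17^2 = 289]. *)
exfalso; pose e := (k %/ 16)%N.
have ek : (16 * e <= k)%N by rewrite /e; lia.
have ke : (k <= 16 * e + 15)%N by rewrite /e; lia.
have e16 : (16 <= e)%N by rewrite /e; lia.
have ker : k%:R <= 16 * e%:R + 15 :> R by rewrite -natrM -natrD ler_nat.
have e16r : 16 <= e%:R :> R by rewrite ler_nat.
have be : (b <= e ^ 2)%N.
  rewrite -(ler_nat R) natrX; apply: (le_trans (ltW bk)).
  have k17 : k%:R <= 17 * e%:R :> R by lra.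
  rewrite ler_pdivrMl ?ltr0n; last by [].
  apply: (@le_trans _ _ ((17 * e%:R) ^+ 2)).
    by rewrite lerXn2r ?nnegrE // mulr_ge0.
  by rewrite exprMn ler_wpM2r ?sqr_ge0 // -natrX ler_nat.
have kep : 32^-1 * k%:R <= e%:R :> R by lra.
have me : (m <= 2 ^ e)%N.
  by rewrite -(ler_nat R); apply: le_trans (ltW mk) (powR2_le kep).
have ne : (n <= 2 ^ e)%N.
  have n0 : 0 < n%:R :> R by rewrite ltr0n (leq_trans _ kn) // (leq_trans _ k256).
  rewrite -(ler_nat R); apply: le_trans (powR2_le kep).
  rewrite -[n%:R]lnK ?posrE // /powR pnatr_eq0 /= ler_expR.
  move: nk; rewrite mulrAC ltr_pdivrMr // => /ltW; lra.
have := le_trans succ (success_prob_le R B (leq_trans _ e16) be me ek kn ne).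
rewrite lerD2l => /(_ isT).
set a : R := (2 ^ e)%:R => h.
have a0 : 0 < a by rewrite ltr0n expn_gt0.
have fe : f k <= e%:R.
  by apply: le_trans (ler_norm _) (le_trans fkk _); rewrite ger0_norm.
(* The assumed advantage is at least [1 / a] because [f k <= e], while the bound is [3 / a^2]; this
   forces [a <= 3]. *)
have : a^-1 <= 3 / a ^+ 2.
  apply: le_trans h; rewrite powRN lef_pV2 ?posrE ?powR_gt0 //.
  exact: powR2_le.
rewrite ler_pdivlMr ?exprn_gt0 // expr2 mulrA mulVf ?gt_eqF // mul1r => a3.
have a4 : 4 <= a by rewrite ler_nat (@leq_exp2l 2 2 e) // (leq_trans _ e16).
by have := le_trans a4 a3; rewrite ler_nat.
Unshelve. all: by end_near.
Qed.
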